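(* (1) For any $\lambda\in[0,1)$: $\omega\text{-}\mathrm{RL}\not\subseteq\mathbb{L}^{>\lambda}(\mathrm{QBA}|\mathrm{ND})$. (2) For any $\lambda\in[0,1)$: $\omega\text{-}\mathrm{CFL}\setminus\omega\text{-}\mathrm{RL}\not\subseteq\mathbb{L}^{>\lambda}(\mathrm{QBA}|\mathrm{ND})$. (3) For any $\lambda\in(0,1)$: $\mathbb{L}^{>\lambda}(\mathrm{QBA}|\mathrm{ND})\not\subseteq\omega\text{-}\mathrm{RL}$. (4) $\mathbb{L}^{=1}(\mathrm{QBA}|\mathrm{ND})\not\subseteq\omega\text{-}\mathrm{RL}$. (5) $\mathbb{L}^{=1}(\mathrm{QBA}|\mathrm{ND})\not\subseteq\omega\text{-}\mathrm{CFL}$.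
   Context: A quantum automaton is a tuple $\mathcal{A}=(\mathcal{H},|s_0\rangle,\Sigma,\{U_\sigma:\sigma\in\Sigma\},F)$ where $\mathcal{H}$ is a finite-dimensional complex Hilbert space, $|s_0\rangle$ a unit vector, $\Sigma$ a finite alphabet, each $U_\sigma$ unitary, and $F$ a subspace. For $w=\sigma_1\sigma_2\cdots\in\Sigma^\omega$ the non-disturbing run is $|s_n\rangle=U_{\sigma_n}\cdots U_{\sigma_1}|s_0\rangle$, and $f^{\mathrm{ND}}_{\mathcal{A}}(w)=\sup_{|\psi\rangle}\sup_{\{n_i\}}\inf_{i\ge1}|\langle\psi|s_{n_i}\rangle|^2$ (sup over unit $|\psi\rangle\in F$ and strictly increasing sequences $0\le n_1<n_2<\cdots$). $\mathcal{L}^{>\lambda}(\mathcal{A}|\mathrm{ND})=\{w:f^{\mathrm{ND}}_{\mathcal{A}}(w)>\lambda\}$, $\mathcal{L}^{=1}(\mathcal{A}|\mathrm{ND})=\{w:f^{\mathrm{ND}}_{\mathcal{A}}(w)=1\}$; $\mathbb{L}^{>\lambda}(\mathrm{QBA}|\mathrm{ND})$ and $\mathbb{L}^{=1}(\mathrm{QBA}|\mathrm{ND})$ are the classes of all such languages over all quantum automata. $\omega\text{-}\mathrm{RL}$ (resp. $\omega\text{-}\mathrm{CFL}$), the $\omega$-regular (resp. $\omega$-context-free) languages, is the class of all $\omega$-languages of the form $\bigcup_{i=1}^n U_iV_i^\omega$ with $n\in\mathbb{N}$ and $U_i,V_i$ regular (resp. context-free) languages of finite words, where $V^\omega$ is the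 set of infinite concatenations of nonempty words from $V$. *)

(* Defs.v *)
From HB Require Import structures.
From mathcomp Require Import all_boot all_order all_algebra.
From mathcomp Require Import complex.
From mathcomp Require Import classical_sets reals Rstruct.

Set Implicit Arguments.
Unset Strict Implicit.
Unset Printing Implicit Defensive.

Import Order.TTheory GRing.Theory Num.Theory.
Local Open Scope ring_scope.

Notation C := (complex Rdefinitions.R).

Definition oword (S : finType) := nat -> S.
Definition lang (S : finType) := seq S -> Prop.
Definition olang (S : finType) := oword S -> Prop.

Record dfa (S : finType) := DFA {
  dfa_state : finType;
  dfa_init : dfa_state;
  dfa_trans : dfa_state -> S -> dfa_state;
  dfa_final : pred dfa_state }.
Arguments dfa_init {S} d.
Arguments dfa_trans {S} d _ _.
Arguments dfa_final {S} d _.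

Definition dfa_accepts (S : finType) (A : dfa S) (u : seq S) : bool :=
  dfa_final A (foldl (dfa_trans A) (dfa_init A) u).

Definition regular (S : finType) (L : lang S) : Prop :=
  exists A : dfa S, forall u, L u <-> dfa_accepts A u.

Record cfg (S : finType) := CFG {
  cfg_nt : finType;
  cfg_start : cfg_nt;
  cfg_rules : seq (cfg_nt * seq (cfg_nt + S)) }.
Arguments cfg_start {S} c.
Arguments cfg_rules {S} c.

Inductive gen (S : finType) (G : cfg S) : cfg_nt G -> seq S -> Prop :=
| gen_rule X rhs w :
    (X, rhs) \in cfg_rules G -> @gens S G rhs w -> @gen S G X w
with gens (S : finType) (G : cfg S) : seq (cfg_nt G + S) -> seq S -> Prop :=
| gens_nil : @gens S G [::] [::]
| gens_t a r w : @gens S G r w -> @gens S G (inr a :: r) (a :: w)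
| gens_nt Y r u v :
    @gen S G Y u -> @gens S G r v -> @gens S G (inl Y :: r) (u ++ v).

Definition context_free (S : finType) (L : lang S) : Prop :=
  exists G : cfg S, forall u, L u <-> @gen S G (cfg_start G) u.

(* V^omega: infinite concatenations of nonempty words of V; the breakpoints
   b 0 = 0 < b 1 < b 2 < ... cut w into the factors w[b k, b (k+1)). *)
Definition omega_pow (S : finType) (V : lang S) : olang S :=
  fun w => exists b : nat -> nat, b 0 = 0%N /\ (forall k, (b k < b k.+1)%N) /\
    forall k, V [seq w i | i <- iota (b k) (b k.+1 - b k)].

Definition oconcat (S : finType) (u : seq S) (w : oword S) : oword S :=
  fun i => if (i < size u)%N then nth (w 0%N) u i else w (i - size u)%N.

Definition lconcat (S : finType) (U : lang S) (L : olang S) : olang S :=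
  fun w => exists u w', U u /\ L w' /\ forall i, w i = oconcat u w' i.

Definition omega_regular (S : finType) (L : olang S) : Prop :=
  exists (n : nat) (U V : nat -> lang S),
    (forall i, (i < n)%N -> regular (U i) /\ regular (V i)) /\
    forall w, L w <-> exists2 i, (i < n)%N & lconcat (U i) (omega_pow (V i)) w.

Definition omega_cf (S : finType) (L : olang S) : Prop :=
  exists (n : nat) (U V : nat -> lang S),
    (forall i, (i < n)%N -> context_free (U i) /\ context_free (V i)) /\
    forall w, L w <-> exists2 i, (i < n)%N & lconcat (U i) (omega_pow (V i)) w.

Definition dotc (d : nat) (u v : 'cV[C]_d) : C := \sum_i conjc (u i 0) * v i 0.

Definition adjmx (d : nat) (U : 'M[C]_d) : 'M[C]_d := map_mx conjc U^T.

Definition unitary (d : nat) (U : 'M[C]_d) : Prop := adjmx U *m U = 1%:M.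

Definition sqmod (z : C) : Rdefinitions.R :=
  complex.Re z ^+ 2 + complex.Im z ^+ 2.

(* the subspace F is the row space of the matrix F; psi belongs to it iff
   psi^T lies in that row space *)
Definition in_subspace (d : nat) (F : 'M[C]_d) (psi : 'cV[C]_d) : bool :=
  (psi^T <= F)%MS.

Record qa (S : finType) := QA {
  qa_dim : nat;
  qa_s0 : 'cV[C]_qa_dim;
  qa_U : S -> 'M[C]_qa_dim;
  qa_F : 'M[C]_qa_dim;
  qa_s0_unit : dotc qa_s0 qa_s0 = 1;
  qa_U_unitary : forall a, unitary (qa_U a) }.
Arguments qa_dim {S} q.
Arguments qa_s0 {S} q.
Arguments qa_U {S} q _.
Arguments qa_F {S} q.

(* |s_n> = U_{sigma_n} ... U_{sigma_1} |s_0>, with sigma_{k+1} = w k *)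
Fixpoint qa_run (S : finType) (A : qa S) (w : oword S) (n : nat)
  : 'cV[C]_(qa_dim A) :=
  match n with
  | 0 => qa_s0 A
  | n.+1 => qa_U A (w n) *m qa_run A w n
  end.

Definition f_ND (S : finType) (A : qa S) (w : oword S) : Rdefinitions.R :=
  sup (fun x : Rdefinitions.R =>
    exists psi : 'cV[C]_(qa_dim A),
      in_subspace (qa_F A) psi /\ dotc psi psi = 1 /\
      exists n : nat -> nat, (forall i, (n i < n i.+1)%N) /\
        x = inf (fun y : Rdefinitions.R =>
                   exists i, y = sqmod (dotc psi (qa_run A w (n i))))).

Definition L_gt (S : finType) (lam : Rdefinitions.R) (A : qa S) : olang S :=
  fun w => lam < f_ND A w.

Definition L_eq1 (S : finType) (A : qa S) : olang S :=
  fun w => f_ND A w = 1.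

Definition in_QBA_gt (S : finType) (lam : Rdefinitions.R) (L : olang S) : Prop :=
  exists A : qa S, forall w, L w <-> L_gt lam A w.

(* Main.v *)
Require Import Defs.
From mathcomp Require Import all_boot all_order all_algebra.
From mathcomp Require Import complex.
From mathcomp Require Import boolp classical_sets reals Rstruct.
From mathcomp Require Import zify ring lra.
Import Order.TTheory GRing.Theory Num.Theory.
Import ComplexField.Normc.
Set Implicit Arguments.
Unset Strict Implicit.
Unset Printing Implicit Defensive.
Local Open Scope ring_scope.

(** Below, c is a letter that acts as the identity, so that words u c^omega
    probe the automaton after the finite word u.

    (1), (2): powers of a unitary are recurrent, so a^k w stays above the
    threshold with w for some k > 0; but the languages {c^omega} and
    {a^n b^n c^omega} contain no a^k c^omega with k > 0.  An omega-regular
    language has finitely many left quotients, which {a^n b^n c^omega} has not.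

    (3): rotate by z = (3 + 4i) / 5 with a and by its conjugate with b, and observe
    in a direction where a^n b^n c^omega has value exactly lam.  If a^i and a^j
    had the same quotient with z^i close to, but different from, z^j, then neither
    a^i b^j c^omega nor a^j b^i c^omega would exceed lam, yet the small rotations
    z^(i-j) and z^(j-i) move the value in opposite directions.

    (4), (5): let three letters each rotate their own coordinate by z.  The value of
    u c^omega is 1 iff the three letters occur equally often in u, because z is
    not a root of unity.  *)

(** * Prefixes and suffixes of infinite words, and factorizations in V^omega *)

Section Words.
Variable S : finType.
Implicit Types (u v x y : seq S) (w : oword S) (U V : lang S).

Definition oshift (n : nat) w : oword S := fun i => w (n + i)%N.

Lemma oconcat_lt u w i s0 : (i < size u)%N -> oconcat u w i = nth s0 u i.
Proof. by move=> lt_iu; rewrite /oconcat lt_iu; apply: set_nth_default. Qed.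

Lemma oconcat_addn u w i : oconcat u w (size u + i)%N = w i.
Proof. by rewrite /oconcat ltnNge leq_addr addKn. Qed.

Lemma oconcat_cat u v w : oconcat (u ++ v) w = oconcat u (oconcat v w).
Proof.
apply: funext => i; rewrite /oconcat size_cat nth_cat.
have [lt_iu|le_ui] := ltnP i (size u).
  by rewrite (leq_trans lt_iu (leq_addr _ _)); apply: set_nth_default.
by rewrite ltn_subLR // subnDA.
Qed.

Lemma oconcat0 w : oconcat [::] w = w.
Proof. by apply: funext => i; rewrite /oconcat subn0. Qed.

Lemma mkseq_oconcat u w n : mkseq (oconcat u w) (size u + n) = u ++ mkseq w n.
Proof.
apply: (@eq_from_nth _ (w 0%N)); first by rewrite size_cat !size_mkseq.
move=> i; rewrite size_mkseq => lt_i; rewrite nth_mkseq // nth_cat.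
have [lt_iu|le_ui] := ltnP i (size u); first exact: oconcat_lt.
by rewrite nth_mkseq ?ltn_subLR // -[in LHS](subnKC le_ui) oconcat_addn.
Qed.

Lemma oconcat_mkseq w n : oconcat (mkseq w n) (oshift n w) = w.
Proof.
apply: funext => i; have [lt_in|le_ni] := ltnP i n.
  by rewrite (oconcat_lt _ (w 0%N)) ?size_mkseq // nth_mkseq.
by rewrite /oconcat size_mkseq ltnNge le_ni /= /oshift subnKC.
Qed.

Lemma oconcat_prefix u v w w' : oconcat u w = oconcat v w' ->
  (size u <= size v)%N -> exists2 x, v = u ++ x & w = oconcat x w'.
Proof.
move=> e le_uv; have := mkseq_oconcat u w (size v - size u).
rewrite e subnKC // -[X in mkseq _ X]addn0 mkseq_oconcat cats0 => ev.
move: ev; set x := mkseq w _ => ev; exists x => //; apply: funext => i.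
have := congr1 (fun f => f (size u + i)%N) e.
by rewrite {1}ev oconcat_cat !oconcat_addn.
Qed.

Lemma omega_pow_cons V y w : V y -> (0 < size y)%N -> omega_pow V w ->
  omega_pow V (oconcat y w).
Proof.
move=> Vy y0 [b [b0 [bS bV]]].
exists (fun k => if k is k'.+1 then size y + b k' else 0)%N; split=> //.
split=> [[|k]|[|k]]; first by rewrite b0 addn0.
- by rewrite ltn_add2l.
- rewrite b0 addn0 subn0.
  by have := mkseq_oconcat y w 0; rewrite addn0 cats0 /mkseq => ->.
rewrite subnDl iotaDl -map_comp (_ : map _ _ = [seq w i | i <- iota (b k) (b k.+1 - b k)]) //.
by apply: eq_map => i /=; rewrite oconcat_addn.
Qed.

Lemma omega_pow_peel V w : omega_pow V w ->
  exists y w', [/\ V y, (0 < size y)%N, w = oconcat y w' & omega_pow V w'].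
Proof.
move=> [b [b0 [bS bV]]].
have b1 k : (b 1%N <= b k.+1)%N.
  by elim: k => // k IH; apply: leq_trans IH (ltnW (bS _)).
exists (mkseq w (b 1%N)), (oshift (b 1%N) w); split.
- by have := bV 0%N; rewrite b0 subn0.
- by rewrite size_mkseq -{1}b0.
- by rewrite oconcat_mkseq.
exists (fun k => b k.+1 - b 1%N)%N; split; first by rewrite subnn.
split=> k; first by rewrite ltn_sub2r // (leq_ltn_trans (b1 k)).
rewrite subnBA // subnK // (_ : map _ _ = [seq w i | i <- iota (b k.+1) (b k.+2 - b k.+1)]) //.
rewrite -[X in _ = [seq w i | i <- iota X _]](subnKC (b1 k)) iotaDl -map_comp; apply: eq_map => i.
by rewrite /oshift /=.
Qed.

Lemma lconcatP U (L : olang S) w :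
  lconcat U L w <-> exists u w', [/\ U u, L w' & w = oconcat u w'].
Proof.
split=> [[u [w' [Uu [Lw' e]]]]|[u [w' [Uu Lw' ->]]]]; exists u, w' => //.
by split=> //; apply: funext.
Qed.

End Words.

(** * Omega-regular languages have finitely many left quotients *)

Section FiniteIndex.
Variable S : finType.

(** The labelling refines equality of left quotients: as [u] and [v] may be swapped, the implication
    gives an equivalence. *)
Definition finite_index (L : olang S) : Prop :=
  exists (Q : finType) (h : seq S -> Q),
    forall u v, h u = h v -> forall w, L (oconcat u w) -> L (oconcat v w).

(** This is U V^*, with nonempty factors from V as in [omega_pow]. *)
Inductive lstar (U V : lang S) : lang S :=
| lstar0 x : U x -> lstar U V x
| lstarS x y : lstar U V x -> V y -> (0 < size y)%N -> lstar U V (x ++ y).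

Lemma lstar_lconcat U V x w : lstar U V x -> omega_pow V w ->
  lconcat U (omega_pow V) (oconcat x w).
Proof.
move=> Ux; elim: Ux w => {x} [x Ux|x y _ IH Vy y0] w Vw.
  by apply/lconcatP; exists x, w.
by rewrite oconcat_cat; apply/IH/omega_pow_cons.
Qed.

Lemma lstar_cut U V x w n : lstar U V x -> omega_pow V w -> (size x <= n)%N ->
  exists x' y w', [/\ lstar U V x', V y, omega_pow V w',
    oconcat x w = oconcat x' (oconcat y w') & (size x' <= n < size x' + size y)%N].
Proof.
have [k] := ubnP (n - size x); elim: k x w => // k IH x w lek Ux Vw lexn.
have [y [w' [Vy y0 ew Vw']]] := omega_pow_peel Vw.
have [lt_n|le_n] := ltnP n (size x + size y).
  by exists x, y, w'; split=> //; [rewrite ew | rewrite lexn].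
rewrite ew -oconcat_cat; apply: IH => //; rewrite ?size_cat //; last exact: lstarS.
by lia.
Qed.

(** The label of [u] is the state of [A] after [u], with the set of states of [B] after the
    unfinished V-factor, over all ways to split off a prefix in U V^*. If [u] ends inside the
    U-word, the first component lets [v] replace it; if [u] ends inside a V-factor, the second gives
    a splitting of [v] whose unfinished factor is completed by the same continuation. *)
Lemma finite_index_lconcat (U V : lang S) : regular U -> regular V ->
  finite_index (lconcat U (omega_pow V)).
Proof.
move=> [A AU] [B BV].
pose dA := foldl (dfa_trans A) (dfa_init A).
pose dB := foldl (dfa_trans B) (dfa_init B).
pose part u q := exists x y, [/\ u = x ++ y, lstar U V x & dB y = q].
exists (dfa_state A * {set dfa_state B})%type.
exists (fun u => (dA u, [set q | `[< part u q >]])) => u v [eA eB] w.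
move=> /lconcatP [x [w' [Ux Vw' e]]].
have [le_ux|lt_xu] := leqP (size u) (size x).
  have [t xE ->] := oconcat_prefix e le_ux.
  rewrite -oconcat_cat; apply/lconcatP; exists (v ++ t), w'; split=> //.
  apply/AU; move/AU: Ux.
  by rewrite xE /dfa_accepts !foldl_cat -/(dA u) -/(dA v) eA.
have [X [y [w1 [UX Vy Vw1 e1 /andP [leX ltX]]]]] :=
  lstar_cut (lstar0 V Ux) Vw' (ltnW lt_xu).
rewrite e1 in e.
have [s uE e2] := oconcat_prefix (esym e) leX.
have [|t yE wE] := oconcat_prefix (esym e2).
  by rewrite -(leq_add2l (size X)) -size_cat -uE ltnW.
have : dB s \in [set q | `[< part u q >]].
  by rewrite inE; apply/asboolP; exists X, s.
rewrite eB inE => /asboolP [X' [s' [vE UX' eq]]].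
rewrite wE vE -!oconcat_cat -catA; apply: lstar_lconcat => //; apply: lstarS => //.
  apply/BV; move/BV: Vy.
  by rewrite yE /dfa_accepts !foldl_cat -/(dB s) -/(dB s') eq.
by move: ltX; rewrite uE yE !size_cat; lia.
Qed.

Lemma omega_regular_finite_index (L : olang S) : omega_regular L -> finite_index L.
Proof.
move=> [n [U [V [reg LE]]]].
suff [Q [h hP]] : finite_index
    (fun w => exists2 i, (i < n)%N & lconcat (U i) (omega_pow (V i)) w).
  by exists Q, h => u v /hP hw w /LE/hw/LE.
elim: n {L LE} reg => [|n IH] reg.
  by exists unit, (fun _ => tt); move=> u v _ w [].
have [i lt_in|Q1 [h1 P1]] := IH; first exact/reg/ltnW.
have [rU rV] := reg n (ltnSn n).
have [Q2 [h2 P2]] := finite_index_lconcat rU rV.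
exists (Q1 * Q2)%type, (fun u => (h1 u, h2 u)) => u v [e1 e2] w [ i ].
rewrite ltnS leq_eqVlt => /predU1P [->|lt_in] Lw.
  by exists n => //; exact: P2 Lw.
have [|j lt_jn Lj] := P1 _ _ e1 w; first by exists i.
by exists j => //; exact: leq_trans lt_jn _.
Qed.

End FiniteIndex.

(** * Balanced derivations of factors of a^n b^n d^n c^omega *)

Section ContextFree.
Variables (S : finType) (a b d c : S).
Hypothesis abdc : uniq [:: a; b; d; c].

Definition balanced (u : seq S) : Prop :=
  count_mem a u = count_mem b u /\ count_mem b u = count_mem d u.

(** The word a^n b^n d^n c^omega, by cases on the position, so that counting letters in a factor is
    interval arithmetic. *)
Definition blocks (n : nat) : oword S := fun i =>
  if (i < n)%N then a else if (i < n + n)%N then b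
  else if (i < n + n + n)%N then d else c.

Definition factor (w : oword S) (i l : nat) : seq S := [seq w j | j <- iota i l].

Let neqs : (a == b = false) * (b == a = false) * (a == d = false) * (d == a = false) *
  (a == c = false) * (c == a = false) * (b == d = false) * (d == b = false) *
  (b == c = false) * (c == b = false) * (d == c = false) * (c == d = false).
Proof.
move: abdc; rewrite /= !inE !negb_or !andbT.
move=> /andP [/and3P [ab ad ac] /andP [/andP [bd bc] dc]].
by rewrite (eq_sym b a) (eq_sym d a) (eq_sym c a) (eq_sym d b) (eq_sym c b) (eq_sym c d)
  (negPf ab) (negPf ad) (negPf ac) (negPf bd) (negPf bc) (negPf dc).
Qed.

Lemma factor_cat w i u v : u ++ v = factor w i (size (u ++ v)) ->
  u = factor w i (size u) /\ v = factor w (i + size u) (size v).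
Proof.
rewrite size_cat /factor iotaD map_cat => /eqP.
by rewrite eqseq_cat ?size_map ?size_iota // => /andP [/eqP ? /eqP ?].
Qed.

Lemma blocks_eq n i : ((blocks n i == a) = (i < n)%N) * ((blocks n i == b) = (n <= i < n + n)%N) *
  ((blocks n i == d) = (n + n <= i < n + n + n)%N).
Proof.
by rewrite /blocks; case: ltnP => h1; [|case: ltnP => h2; [|case: ltnP => h3]];
  rewrite ?eqxx ?neqs; repeat split; lia.
Qed.

Lemma count_blocks n x i l : count_mem x (factor (blocks n) i l) =
  count (fun j => blocks n j == x) (iota i l).
Proof. by rewrite count_map. Qed.

Lemma blocks_bridge n i l : a \in factor (blocks n) i l -> d \in factor (blocks n) i l ->
  count_mem b (factor (blocks n) i l) = n.
Proof.
move=> /mapP [j]; rewrite mem_iota => ij /esym/eqP; rewrite !blocks_eq => jn.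
move=> /mapP [k]; rewrite mem_iota => ik /esym/eqP; rewrite !blocks_eq => kn.
(* The three pieces lie before, on and after the b-block. *)
rewrite count_blocks (_ : l = (n - i) + (n + (i + l - (n + n))))%N; last by lia.
rewrite !iotaD !count_cat.
rewrite (@eq_in_count _ _ pred0); last by move=> m; rewrite mem_iota !blocks_eq /=; lia.
rewrite [X in (_ + (X + _))%N](@eq_in_count _ _ predT);
  last by move=> m; rewrite mem_iota !blocks_eq /=; lia.
rewrite [X in (_ + (_ + X))%N](@eq_in_count _ _ pred0);
  last by move=> m; rewrite mem_iota !blocks_eq /=; lia.
by rewrite !count_pred0 count_predT size_iota addn0.
Qed.

Scheme gen_mind := Minimality for gen Sort Prop
  with gens_mind := Minimality for gens Sort Prop.

Variable G : cfg S.

(** Fix one word for each of the finitely many nonterminals, a dummy one if nothing is generated,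
    and take the greatest length. *)
Lemma gen_short : exists M, forall (X : cfg_nt G) w, gen X w ->
  exists2 w', gen X w' & (size w' <= M)%N.
Proof.
have /fin_all_exists [f fP] (X : cfg_nt G) : exists w, forall w', gen X w' -> gen X w.
  have [[w Xw]|nX] := pselect (exists w, gen X w); first by exists w.
  by exists [::] => w' Xw'; case: nX; exists w'.
exists (\max_X size (f X)) => X w Xw; exists (f X); first exact: fP Xw.
exact: (leq_bigmax X).
Qed.

Lemma rule_short : exists R, forall X r, (X, r) \in cfg_rules G -> (size r <= R)%N.
Proof.
exists (\max_(p <- cfg_rules G) size p.2) => X r Xr.
exact: (@leq_bigmax_seq _ _ predT (fun p : cfg_nt G * seq (cfg_nt G + S) => size p.2) (X, r)).
Qed.

(** One context balances all of [K]. This passes from a parse-tree node to its children, the words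
    of the siblings being absorbed into the context. *)
Definition fits (K : seq S -> Prop) : Prop :=
  exists p q, forall u, K u -> balanced (p ++ u ++ q).

(** In a common context [w] and [w'] have the same differences of letter counts, and those of [w']
    are at most [M]. *)
Lemma fits_imbalance (K : seq S -> Prop) M w w' : fits K -> K w -> K w' -> (size w' <= M)%N ->
  [/\ (count_mem b w <= count_mem a w + M)%N, (count_mem a w <= count_mem b w + M)%N,
      (count_mem d w <= count_mem b w + M)%N & (count_mem b w <= count_mem d w + M)%N].
Proof.
move=> [p [q pq]] /pq [] + + /pq [] + + sz; rewrite !count_cat.
have cs x : (count_mem x w' <= M)%N := leq_trans (count_size _ _) sz.
by have := cs a; have := cs b; have := cs d; split; lia.
Qed.

Definition weight (u : seq S) : nat := (count_mem a u + count_mem b u + count_mem d u)%N.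

(* In a context where every derivation is balanced, each nonterminal produces a
   bounded imbalance.  A factor of a^n b^n d^n c^omega of bounded imbalance is
   either light or contains the whole b-block; the number of children being bounded, a
   parse tree cannot pass from light subtrees to one containing the b-block. *)
Lemma gen_light M R n :
  (forall (X : cfg_nt G) w, gen X w -> exists2 w', gen X w' & (size w' <= M)%N) ->
  (forall X r, (X, r) \in cfg_rules G -> (size r <= R)%N) ->
  (R * (3 * M).+1 < n)%N ->
  forall (X : cfg_nt G) w, gen X w -> forall i, w = factor (blocks n) i (size w) ->
  fits (gen X) -> (weight w <= 3 * M)%N.
Proof.
move=> short rules big.
(* A right-hand side is allowed 3M + 1 per symbol: a nonterminal contributes at most 3M, a terminal
   at most 1. *)
apply: (@gen_mind S G _ (fun r w => forall i, w = factor (blocks n) i (size w) ->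
  fits (gens r) -> (weight w <= size r * (3 * M).+1)%N)).
- move=> X r w Xr rw IH i wE fit.
  have {}IH : (weight w <= R * (3 * M).+1)%N.
    apply: leq_trans (leq_mul (rules _ _ Xr) (leqnn _)).
    apply: (IH i wE); case: fit => p [q pq]; exists p, q => u ru.
    by apply: pq; apply: gen_rule Xr ru.
  have Xw := gen_rule Xr rw; have [w' Xw' sz] := short _ _ Xw.
  have [h1 h2 h3 h4] := fits_imbalance fit Xw Xw' sz.
  (* Without a or without d, the imbalance bounds the other two counts by M and 2M. With both, the
     b-block alone exceeds the bound obtained from the children. *)
  have [aw|/count_memPn a0] := boolP (a \in w); last by rewrite /weight; lia.
  have [dw|/count_memPn d0] := boolP (d \in w); last by rewrite /weight; lia.
  rewrite wE in aw dw; have := blocks_bridge aw dw; rewrite -wE => bn.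
  by move: IH; rewrite /weight; lia.
- by [].
- move=> x r w rw IH i wE fit.
  have [|_ wE'] := @factor_cat (blocks n) i [:: x] w; first exact: wE.
  have : (weight w <= size r * (3 * M).+1)%N.
    apply: (IH _ wE'); case: fit => p [q pq]; exists (p ++ [:: x]), q => u ru.
    by rewrite -catA; apply: (pq (x :: u)); apply: gens_t.
  rewrite /weight /=.
  have : ((x == a) + (x == b) + (x == d) <= 1)%N.
    by have [->|_] := eqVneq x a; rewrite ?neqs //;
      have [->|_] := eqVneq x b; rewrite ?neqs // leq_b1.
  by rewrite mulSn; lia.
- move=> Y r u v Yu IHu rv IHv i wE [p [q pq]].
  have [uE vE] := factor_cat wE.
  have wu : (weight u <= 3 * M)%N.
    apply: (IHu _ uE); exists p, (v ++ q) => u' Yu'.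
    by rewrite [u' ++ _]catA; apply: pq; apply: gens_nt.
  have wv : (weight v <= size r * (3 * M).+1)%N.
    apply: (IHv _ vE); exists (p ++ u), q => v' rv'.
    by rewrite -catA [u ++ _]catA; apply: pq; apply: gens_nt.
  by move: wu wv; rewrite /weight !count_cat /= mulSn; lia.
Qed.

End ContextFree.

(** * A language outside the omega-context-free class *)

Section NotOmegaCF.
Variables (S : finType) (a b d c : S).
Hypothesis abdc : uniq [:: a; b; d; c].

Lemma cf_balanced_bounded (K : lang S) : context_free K ->
  exists T, (forall u, K u -> balanced a b d u) ->
  forall n i l, (T < n)%N -> K (factor (blocks a b d c n) i l) ->
  count_mem b (factor (blocks a b d c n) i l) <> n.
Proof.
move=> [G KG]; have [M short] := gen_short G; have [R rules] := rule_short G.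
(* The first summand meets the size hypothesis of [gen_light]; the second makes [n] letters b
   heavier than its bound 3M. *)
exists (R * (3 * M).+1 + 3 * M)%N => bal n i l ltn /KG Kw cb.
have : (weight a b d (factor (blocks a b d c n) i l) <= 3 * M)%N.
  have big : (R * (3 * M).+1 < n)%N by apply: leq_trans ltn; rewrite ltnS leq_addr.
  apply: (gen_light abdc short rules big Kw (i := i)).
    by rewrite size_map size_iota.
  by exists [::], [::] => u /KG /bal; rewrite cats0.
by apply/negP; rewrite -ltnNge /weight cb; move: ltn; lia.
Qed.

Lemma finite_bound (n : nat) (P : nat -> nat -> Prop) :
  (forall i T T', P i T -> (T <= T')%N -> P i T') ->
  (forall i, (i < n)%N -> exists T, P i T) -> exists T, forall i, (i < n)%N -> P i T.
Proof.
move=> mono; elim: n => [|n IH] h; first by exists 0%N.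
have [i lt_in|T1 h1] := IH; first exact/h/ltnW.
have [T2 h2] := h n (ltnSn n).
exists (maxn T1 T2) => i; rewrite ltnS leq_eqVlt => /predU1P [->|lt_in].
  by apply: mono h2 _; exact: leq_maxr.
by apply: mono (h1 _ lt_in) _; exact: leq_maxl.
Qed.

Definition ocst (x : S) : oword S := fun _ => x.

(** Padding [u] and [v] to a common length adds only letters c. *)
Lemma count_oconcat_cst u v x : x != c ->
  oconcat u (ocst c) = oconcat v (ocst c) -> count_mem x u = count_mem x v.
Proof.
move=> xc e; have := mkseq_oconcat u (ocst c) (size v).
rewrite e addnC mkseq_oconcat => /(congr1 (count_mem x)).
have z n : count_mem x (mkseq (ocst c) n) = 0%N.
  by apply/count_memPn/mapP => -[i _ xE]; rewrite xE eqxx in xc.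
by rewrite !count_cat !z !addn0.
Qed.

Lemma blocks_nseq m : blocks a b d c m =
  oconcat (nseq m a ++ nseq m b ++ nseq m d) (ocst c).
Proof.
apply: funext => i; rewrite /blocks /oconcat /ocst !size_cat !size_nseq.
rewrite !nth_cat !size_nseq !nth_nseq.
have [h1|h1] := ltnP i m; first by rewrite (leq_trans h1) ?leq_addr.
rewrite ltn_subLR //; have [h2|h2] := ltnP i (m + m);
  first by rewrite addnA (leq_trans h2) ?leq_addr.
by rewrite !ltn_subLR ?addnA //; case: ltnP => //; lia.
Qed.

(** Factor a long [blocks] word in some U_i V_i^omega. Either the U-word covers all three blocks, or
    the first V-factor starts inside them. In each case the language concerned has only balanced
    words, and its word contains the whole b-block, against [cf_balanced_bounded]. *)
Lemma not_omega_cf (L : olang S) :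
  (forall u, L (oconcat u (ocst c)) <-> balanced a b d u) -> ~ omega_cf L.
Proof.
move=> Lc [n [U [V [cfUV LE]]]].
pose small (K : lang S) T := (forall u, K u -> balanced a b d u) ->
  forall n i l, (T < n)%N -> K (factor (blocks a b d c n) i l) ->
  count_mem b (factor (blocks a b d c n) i l) <> n.
have smallW K T T' : small K T -> (T <= T')%N -> small K T'.
  by move=> KT le_T /KT {}KT k i l lt_k; apply/KT/(leq_ltn_trans le_T).
have [T TP] : exists T, forall i, (i < n)%N -> small (U i) T /\ small (V i) T.
  apply: (@finite_bound n (fun i T => small (U i) T /\ small (V i) T)).
    by move=> i T T' [hU hV] le_T; split; apply: smallW le_T.
  move=> i /cfUV [/cf_balanced_bounded [T1 h1] /cf_balanced_bounded [T2 h2]].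
  exists (maxn T1 T2); split; [apply: smallW h1 _ | apply: smallW h2 _].
    exact: leq_maxl.
  exact: leq_maxr.
set m := T.+1; set W := blocks a b d c m.
move: abdc; rewrite /= !inE !negb_or !andbT.
move=> /andP [/and3P [ab ad ac] /andP [/andP [bd bc] dc]].
have LW : L W.
  rewrite /W blocks_nseq; apply/Lc; rewrite /balanced !count_cat !count_nseq /= !eqxx.
  rewrite (eq_sym b a) (eq_sym d a) (eq_sym d b).
  by rewrite (negPf ab) (negPf ad) (negPf bd) !mul0n !addn0 !add0n.
(* Every suffix of [W] is a finite word followed by c^omega, which makes [Lc] applicable. *)
have tail v w : W = oconcat v w -> w = oconcat (mkseq w (m + m + m)) (ocst c).
  move=> e; rewrite -[LHS](oconcat_mkseq w (m + m + m)); congr oconcat.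
  apply: funext => i; rewrite /oshift -(oconcat_addn v) -e /W /blocks.
  by do 3![case: ltnP; first by lia].
have LU i x w : (i < n)%N -> lstar (U i) (V i) x -> omega_pow (V i) w ->
    L (oconcat x w).
  by move=> lt_in Ux Vw; apply/LE; exists i => //; exact: lstar_lconcat.
have [i lt_in /lconcatP [x [w [Ux Vw WE]]]] := (LE W).1 LW.
have [smU smV] := TP i lt_in.
have [le_x|lt_x] := leqP (m + m + m) (size x).
  have wE : w = ocst c.
    apply: funext => j; rewrite -(oconcat_addn x) -WE /W /blocks.
    by do 3![case: ltnP; first by lia].
  have xE : x = factor W 0 (size x).
    by have := mkseq_oconcat x w 0; rewrite -WE addn0 cats0.
  apply: (smU _ m 0%N (size x)); rewrite // -?/W -?xE //.
    by move=> u Uu; apply/Lc; rewrite -wE; apply: (LU i) => //; exact: lstar0.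
  rewrite (@count_oconcat_cst x (nseq m a ++ nseq m b ++ nseq m d)) //.
    by rewrite !count_cat !count_nseq /= eqxx (negPf ab) (eq_sym d) (negPf bd) !mul0n mul1n addn0.
  by rewrite -blocks_nseq -wE -WE.
have [y [w1 [Vy y0 wE Vw1]]] := omega_pow_peel Vw.
have w1E := tail (x ++ y) w1; rewrite oconcat_cat -wE in w1E.
move: {w1E}(w1E WE); set t := mkseq _ _ => w1E.
have xy0 : balanced a b d (x ++ t).
  by apply/Lc; rewrite oconcat_cat -w1E; apply: (LU i) => //; exact: lstar0.
(* Both x t c^omega and x u t c^omega lie in [L], so the inserted word [u] is balanced. *)
have balV u : V i u -> balanced a b d u.
  case: u => // s u Vu.
  have : balanced a b d ((x ++ s :: u) ++ t).
    apply/Lc; rewrite oconcat_cat -w1E; apply: (LU i) => //.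
    by apply: lstarS => //; exact: lstar0.
  by case: xy0; rewrite /balanced !count_cat; lia.
have yE : y = factor W (size x) (size y).
  have [] := @factor_cat _ W 0 x y => //.
  by have := mkseq_oconcat (x ++ y) w1 0; rewrite oconcat_cat -wE -WE addn0 cats0.
apply: (smV balV m (size x) (size y)); rewrite // -?/W -?yE //.
(* The first letter of [y] is a, b or d; being balanced, [y] then contains all three. *)
have Wxy : W (size x) \in y.
  by rewrite yE map_f // mem_iota leqnn -{1}[size x]addn0 ltn_add2l.
have [e1 e2] := balV _ Vy.
have by0 : (0 < count_mem b y)%N.
  move: Wxy; rewrite /W /blocks; case: ltnP => h1;
    last case: ltnP => h2; last (case: ltnP => h3; last by lia);
    by rewrite -has_pred1 has_count; lia.
rewrite yE; apply: blocks_bridge => //; by rewrite -/W -yE -has_pred1 has_count; lia.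
Qed.

End NotOmegaCF.

(** * Pigeonhole principles for finite labels and bounded real coordinates *)

Section Pigeonhole.

Lemma pigeonhole (Q : finType) (h : nat -> Q) : exists i j, (i < j)%N /\ h i = h j.
Proof.
have /injectivePn [i [j ij hij]] : ~~ injectiveb (fun i : 'I_(#|Q|.+1) => h i).
  by apply/injectiveP => /leq_card; rewrite card_ord ltnn.
have [lt_ij|lt_ji|/val_inj e] := ltngtP i j.
- by exists i, j.
- by exists j, i.
- by rewrite e eqxx in ij.
Qed.

(** Cut [-1, 1] into cells of width 1 / N < e and apply [pigeonhole] to the label together with the
    cells of all coordinates. *)
Lemma pigeonhole_close (R : archiRealFieldType) (I Q : finType) (h : nat -> Q)
    (g : nat -> I -> R) (e : R) :
  0 < e -> (forall n l, `|g n l| <= 1) ->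
  exists i j, [/\ (i < j)%N, h i = h j & forall l, `|g i l - g j l| < e].
Proof.
move=> e0 g1; pose N := (Num.truncn e^-1).+1.
have N0 : 0 < N%:R :> R by rewrite ltr0n.
have Ne : 1 < N%:R * e.
  by rewrite -ltr_pdivrMr // mul1r truncnS_gt.
pose q n l := Num.truncn ((g n l + 1) * N%:R).
have q_itv n l : (q n l)%:R <= (g n l + 1) * N%:R < (q n l).+1%:R.
  apply: truncn_itv; apply: mulr_ge0; last exact: ltW.
  by have := g1 n l; rewrite ler_norml => /andP [h1 _]; lra.
have q_le n l : (q n l < (2 * N).+1)%N.
  rewrite ltnS -(ler_nat R) natrM.
  have /andP [h1 _] := q_itv n l; apply: le_trans h1 _.
  rewrite ler_pM2r //; have := g1 n l; rewrite ler_norml => /andP [_ h2]; lra.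
have [i [j [lt_ij [hij /ffunP qij]]]] :=
  pigeonhole (fun n => (h n, [ffun l => Ordinal (q_le n l)])).
exists i, j; split=> // l; have := qij l; rewrite !ffunE => -[ql].
have := q_itv i l; have := q_itv j l; rewrite ql -natr1 => h1 h2.
rewrite -(ltr_pM2l N0); apply: lt_trans Ne; rewrite -[X in X * `|_|]gtr0_norm // -normrM.
by rewrite ltr_norml; lra.
Qed.

End Pigeonhole.

(** * Some regular and context-free languages, and a criterion for non-regularity *)

Section Languages.
Variable S : finType.

Lemma omega_pow_letter (c : S) w : omega_pow (fun u => u = [:: c]) w <-> w = ocst c.
Proof.
split=> [[b [b0 [bS bV]]]|->]; last first.
  by exists id; split=> //; split=> // k; rewrite subSnn.
have bE k : b k = k.
  elim: k => // k IH; have := congr1 size (bV k); rewrite size_map size_iota /= => e.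
  by rewrite -(subnKC (ltnW (bS k))) e IH addn1.
by apply: funext => i; have := bV i; rewrite !bE subSnn /= => -[].
Qed.

Lemma lconcat_letter U (c : S) w : lconcat U (omega_pow (fun u => u = [:: c])) w <->
  exists2 u, U u & w = oconcat u (ocst c).
Proof.
split=> [/lconcatP [u [w' [Uu /omega_pow_letter -> ->]]]|[u Uu ->]]; first by exists u.
by apply/lconcatP; exists u, (ocst c); split=> //; apply/omega_pow_letter.
Qed.

Lemma regular_nil : regular (fun u : seq S => u = [::]).
Proof.
exists (@DFA S bool true (fun _ _ => false) id) => -[|x u] //; split=> //.
rewrite /dfa_accepts /=; suff -> : foldl (fun _ _ => false) false u = false by [].
by elim: u.
Qed.

Lemma regular_letter (c : S) : regular (fun u => u = [:: c]).
Proof.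
(* [None] is initial, [Some true] means that exactly c was read, and [Some false] is a sink. *)
pose t (q : option bool) x := if q is None then Some (x == c) else Some false.
exists (@DFA S (option bool) None t (pred1 (Some true))) => -[|x [|y u]] //=.
  rewrite /dfa_accepts /=; split=> [[->]|]; first by rewrite eqxx.
  by move/eqP => [/eqP ->].
split=> //; rewrite /dfa_accepts /=.
suff -> : foldl t (Some false) u = Some false by [].
by elim: u.
Qed.

Lemma gen_inv (G : cfg S) (X : cfg_nt G) w : gen X w ->
  exists2 r, (X, r) \in cfg_rules G & gens r w.
Proof. by case=> {}X r {}w Xr rw; exists r. Qed.

Lemma gens_inv (G : cfg S) (r : seq (cfg_nt G + S)) w : gens r w ->
  match r with
  | [::] => w = [::]
  | inr x :: r' => exists2 w', w = x :: w' & gens r' w'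
  | inl Y :: r' => exists u v, [/\ w = u ++ v, gen Y u & gens r' v]
  end.
Proof.
by case=> [|x {}r {}w rw|Y {}r u v Yu rv] //; [exists w | exists u, v].
Qed.

Lemma context_free_letter (c : S) : context_free (fun u => u = [:: c]).
Proof.
exists (@CFG S unit tt [:: (tt, [:: inr c])]) => u; split=> [->|].
  apply: gen_rule; first exact: mem_head.
  by apply: gens_t; exact: gens_nil.
move=> /gen_inv [r]; rewrite mem_seq1 => /eqP [->].
by move=> /gens_inv [w ->] /gens_inv ->.
Qed.

Lemma context_free_anbn (a b : S) :
  context_free (fun u => exists n, u = nseq n a ++ nseq n b).
Proof.
set rules := [:: (tt, [::]); (tt, [:: inr a; inl tt; inr b])].
exists (@CFG S unit tt rules) => u; split=> [[n ->]|].
  elim: n => [|n IH].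
    by apply: gen_rule; [exact: mem_head | exact: gens_nil].
  apply: gen_rule; first by rewrite inE; apply/orP; right; exact: mem_head.
  rewrite -[X in _ ++ nseq X b]addn1 nseqD.
  apply: gens_t; rewrite -/(nseq n a) -/cat catA; apply: gens_nt; first exact: IH.
  by apply: gens_t; exact: gens_nil.
have [n] := ubnP (size u); elim: n u => // n IH u le_un uG.
have [r] := gen_inv uG; rewrite !inE => /orP [] /eqP [->].
  by move/gens_inv => ->; exists 0%N.
move=> /gens_inv [v uE /gens_inv [v1 [v2 [vE gv1 /gens_inv [v3 v2E /gens_inv v3E]]]]].
rewrite {}uE {}vE {}v2E {}v3E in le_un *.
have [|k ->] := IH v1 _ gv1; first by move: le_un; rewrite /= size_cat /=; lia.
by exists k.+1; rewrite -catA -[X in _ = _ ++ nseq X _]addn1 nseqD.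
Qed.

(** The continuation [y i] separates [x i] from every other [x j], so the quotients are infinitely
    many. *)
Lemma not_omega_regular (L : olang S) (x y : nat -> seq S) (c : S) :
  (forall i j, L (oconcat (x i ++ y j) (ocst c)) <-> i = j) -> ~ omega_regular L.
Proof.
move=> LE /omega_regular_finite_index [Q [h hP]].
have [i [j [lt_ij hij]]] := pigeonhole (h \o x).
have := hP _ _ hij (oconcat (y i) (ocst c)).
by rewrite -!oconcat_cat => /(_ ((LE i i).2 erefl)) /LE e; rewrite e ltnn in lt_ij.
Qed.

End Languages.

(** * Norms, unitary matrices and recurrence *)

Local Notation R := Rdefinitions.R.

Section Hilbert.

Definition norm2 (d : nat) (v : 'cV[C]_d) : R := \sum_i sqmod (v i 0).

Lemma sqmodE z : sqmod z = normc z ^+ 2.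
Proof. by case: z => x y; rewrite /sqmod /= sqr_sqrtr // addr_ge0 // sqr_ge0. Qed.

Lemma sqmod_ge0 z : 0 <= sqmod z.
Proof. by rewrite sqmodE sqr_ge0. Qed.

Lemma normc_ge0 (z : C) : 0 <= normc z.
Proof. by case: z => x y; apply: sqrtr_ge0. Qed.

Lemma sqmodM z t : sqmod (z * t) = sqmod z * sqmod t.
Proof. by rewrite !sqmodE normcM exprMn. Qed.

Lemma sqmod_conjc z : sqmod (conjc z) = sqmod z.
Proof. by case: z => x y; rewrite /sqmod /= sqrrN. Qed.

Lemma conjc_mul z : conjc z * z = (sqmod z)%:C%C.
Proof.
case: z => x y; rewrite /sqmod /=; apply/eqP; rewrite eq_complex /=.
by apply/andP; split; apply/eqP; ring.
Qed.

Lemma dotc_norm2 d (v : 'cV[C]_d) : dotc v v = (norm2 v)%:C%C.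
Proof. by rewrite /dotc /norm2 rmorph_sum; apply: eq_bigr => i _; rewrite conjc_mul. Qed.

Lemma dotc_unit d (v : 'cV[C]_d) : dotc v v = 1 <-> norm2 v = 1.
Proof. by rewrite dotc_norm2; split=> [[] | ->]. Qed.

Lemma dotcE d (u v : 'cV[C]_d) : dotc u v = ((map_mx conjc u)^T *m v) 0 0.
Proof. by rewrite mxE; apply: eq_bigr => i _; rewrite !mxE. Qed.

Lemma dotcDr d (u v w : 'cV[C]_d) : dotc u (v + w) = dotc u v + dotc u w.
Proof. by rewrite !dotcE mulmxDr mxE. Qed.

Lemma norm2_unitary d (M : 'M[C]_d) v : unitary M -> norm2 (M *m v) = norm2 v.
Proof.
move=> MM; suff [] : (norm2 (M *m v))%:C%C = (norm2 v)%:C%C by [].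
rewrite -!dotc_norm2 !dotcE.
have -> : (map_mx conjc (M *m v))^T = (map_mx conjc v)^T *m adjmx M.
  by rewrite map_mxM trmx_mul /adjmx -map_trmx.
by rewrite mulmxA -(mulmxA _ (adjmx M)) MM mulmx1.
Qed.

Lemma norm2_iter d (M : 'M[C]_d) v n : unitary M -> norm2 (iter n (mulmx M) v) = norm2 v.
Proof. by move=> MM; elim: n => //= n IH; rewrite norm2_unitary. Qed.

Lemma sqmod_le_norm2 d (v : 'cV[C]_d) i : sqmod (v i 0) <= norm2 v.
Proof.
rewrite /norm2 (bigD1 i) //= lerDl; apply: sumr_ge0 => j _; exact: sqmod_ge0.
Qed.

Lemma normc_sum (I : finType) (F : I -> C) : normc (\sum_i F i) <= \sum_i normc (F i).
Proof.
elim/big_ind2: _ => [|x x' y y' h h'|//]; first by rewrite normc0.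
by apply: le_trans (le_normcD _ _) _; apply: lerD.
Qed.

(** A crude form of Cauchy-Schwarz: each of the [d] terms is at most [k]. The factor [d] is
    harmless, the dimension of an automaton being fixed. *)
Lemma normc_dotc d (u v : 'cV[C]_d) (k : R) : 0 <= k -> norm2 u = 1 -> norm2 v <= k ^+ 2 ->
  normc (dotc u v) <= d%:R * k.
Proof.
move=> k0 u1 vk; apply: le_trans (normc_sum _) _.
rewrite -[X in X%:R * k]card_ord -sum1_card natr_sum mulr_suml; apply: ler_sum => i _.
rewrite normcM; apply: ler_pM; rewrite ?normc_ge0 //.
- rewrite -(ler_pXn2r (n := 2)) ?nnegrE ?normc_ge0 //= -sqmodE expr1n sqmod_conjc -u1.
  exact: sqmod_le_norm2.
- rewrite -(ler_pXn2r (n := 2)) ?nnegrE ?normc_ge0 //= -sqmodE.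
  exact: le_trans (sqmod_le_norm2 _ _) vk.
Qed.

(** The orbit is bounded, so some M^i v and M^j v with i < j are close; M^i preserves norms, so
    M^(j-i) v is equally close to v. *)
Lemma unitary_recurrent d (M : 'M[C]_d) (v : 'cV[C]_d) (e : R) :
  unitary M -> norm2 v = 1 -> 0 < e ->
  exists2 k, (0 < k)%N & norm2 (iter k (mulmx M) v - v) <= e.
Proof.
move=> MM v1 e0; pose s n := iter n (mulmx M) v.
pose g n (l : 'I_d * bool) : R :=
  if l.2 then complex.Re (s n l.1 0) else complex.Im (s n l.1 0).
have g1 n l : `|g n l| <= 1.
  rewrite -(ler_pXn2r (n := 2)) ?nnegrE ?normr_ge0 //= expr1n real_normK ?num_real //.
  rewrite -v1 -(norm2_iter v n MM); apply: le_trans (sqmod_le_norm2 _ l.1).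
  by rewrite /g /sqmod -/(s n); case: l.2; rewrite ?lerDl ?lerDr sqr_ge0.
(* A coordinate contributes at most 2 r^2 <= 2 r, and 2 d r <= e; the + 1 keeps the denominator
   positive. *)
pose r : R := Num.min 1 (e / (2 * d%:R + 1)).
have D0 : 0 <= d%:R :> R by rewrite ler0n.
have r0 : 0 < r by rewrite lt_min ltr01 divr_gt0 //; lra.
have [i [j [lt_ij _ gij]]] := pigeonhole_close (fun _ => tt) r0 g1.
exists (j - i)%N; first by rewrite subn_gt0.
have -> : norm2 (iter (j - i) (mulmx M) v - v) = norm2 (s j - s i).
  have lin m x y : iter m (mulmx M) (x - y) = iter m (mulmx M) x - iter m (mulmx M) y.
    by elim: m => //= m ->; rewrite mulmxBr.
  by rewrite -(norm2_iter _ i MM) lin -iterD subnKC // ltnW.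
apply: (@le_trans _ _ (\sum_(l < d) 2 * r)).
  apply: ler_sum => l _; rewrite !mxE.
  have := gij (l, true); have := gij (l, false); rewrite /g /= /sqmod.
  have r1 : r <= 1 by rewrite ge_min lexx.
  case: (s j l 0) => x y; case: (s i l 0) => x' y' /=; rewrite !ltr_norml => h1 h2.
  by nra.
rewrite sumr_const card_ord -mulr_natr.
have : r <= e / (2 * d%:R + 1) by rewrite ge_min lexx orbT.
by rewrite ler_pdivlMr; nra.
Qed.

End Hilbert.

(** * Runs of an automaton and insertion of a letter power *)

Section Runs.
Variables (S : finType) (A : qa S).
Implicit Types (w : oword S) (u : seq S).

(** The evolution operator apart from the initial state, so that [w] can also be run from the state
    reached after a prefix. *)
Fixpoint run_mx w n : 'M[C]_(qa_dim A) :=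
  if n is m.+1 then qa_U A (w m) *m run_mx w m else 1%:M.

Lemma norm2_run_mx w n v : norm2 (run_mx w n *m v) = norm2 v.
Proof.
elim: n => [|n IH] /=; first by rewrite mul1mx.
by rewrite -mulmxA norm2_unitary ?IH //; exact: qa_U_unitary.
Qed.

Lemma norm2_s0 : norm2 (qa_s0 A) = 1.
Proof. by apply/dotc_unit; exact: qa_s0_unit. Qed.

Lemma qa_runE w n : qa_run A w n = run_mx w n *m qa_s0 A.
Proof. by elim: n => [|n IH] /=; rewrite ?mul1mx // IH mulmxA. Qed.

Lemma norm2_run w n : norm2 (qa_run A w n) = 1.
Proof. by rewrite qa_runE norm2_run_mx norm2_s0. Qed.

Definition apply_word u (v : 'cV[C]_(qa_dim A)) := foldl (fun v a => qa_U A a *m v) v u.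

Lemma qa_run_foldl w n : qa_run A w n = apply_word (mkseq w n) (qa_s0 A).
Proof.
by elim: n => [//|n IH]; rewrite mkseqS /apply_word foldl_rcons -/(apply_word _ _) -IH.
Qed.

Lemma qa_run_oconcat u w n :
  qa_run A (oconcat u w) (size u + n) = run_mx w n *m apply_word u (qa_s0 A).
Proof.
elim: n => [|n IH] /=; last by rewrite addnS /= IH oconcat_addn mulmxA.
by rewrite mul1mx qa_run_foldl mkseq_oconcat cats0.
Qed.

Definition ND_values w : set R := fun x =>
  exists psi : 'cV[C]_(qa_dim A),
    in_subspace (qa_F A) psi /\ dotc psi psi = 1 /\
    exists n : nat -> nat, (forall i, (n i < n i.+1)%N) /\
      x = inf (fun y : R => exists i, y = sqmod (dotc psi (qa_run A w (n i)))).

Lemma f_NDE w : f_ND A w = sup (ND_values w). Proof. by []. Qed.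

Lemma inf_values_le w psi (n : nat -> nat) i :
  inf (fun y : R => exists i, y = sqmod (dotc psi (qa_run A w (n i)))) <=
  sqmod (dotc psi (qa_run A w (n i))).
Proof.
apply: ge_inf; last by exists i.
by exists 0 => _ [j ->]; exact: sqmod_ge0.
Qed.

Lemma le_inf_values w psi (n : nat -> nat) (x : R) :
  (forall i, x <= sqmod (dotc psi (qa_run A w (n i)))) ->
  x <= inf (fun y : R => exists i, y = sqmod (dotc psi (qa_run A w (n i)))).
Proof.
move=> h; apply: lb_le_inf; first by exists (sqmod (dotc psi (qa_run A w (n 0%N)))), 0%N.
by move=> _ [i ->].
Qed.

Lemma ND_values_bounded w : has_ubound (ND_values w).
Proof.
exists ((qa_dim A)%:R ^+ 2) => _ [psi [_ [/dotc_unit psi1 [n [_ ->]]]]].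
apply: le_trans (inf_values_le w psi n 0) _.
rewrite sqmodE ler_pXn2r ?nnegrE ?normc_ge0 ?ler0n //.
by rewrite -[X in _ <= X]mulr1 normc_dotc // norm2_run expr1n.
Qed.

(* Some power of U_a almost fixes s_0, so inserting that power of a in front of w
   barely moves the whole run. *)
Lemma L_gt_prepend lam w a : 0 <= lam -> L_gt lam A w ->
  exists2 k, (0 < k)%N & L_gt lam A (oconcat (nseq k a) w).
Proof.
move=> lam0; rewrite /L_gt f_NDE => lam_lt.
(* The supremum of the empty set is 0 by convention, which does not exceed [lam]. *)
have ne : (ND_values w !=set0)%classic.
  apply/set0P; apply/eqP => E; rewrite E sup0 in lam_lt.
  by rewrite ltNge lam0 in lam_lt.
have [x [psi [Fpsi [psi1 [n [incn xE]]]]] lam_x] := sup_gt ne lam_lt.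
have {}xE i : x <= sqmod (dotc psi (qa_run A w (n i))) by rewrite xE inf_values_le.
have npsi : norm2 psi = 1 by apply/dotc_unit.
set D : R := (qa_dim A)%:R; have D0 : 0 <= D by rewrite ler0n.
(* The loss 2 D^2 e incurred below is then at most half of the gap x - lam. *)
pose e := (x - lam) / (4 * D ^+ 2 + 1).
have e0 : 0 < e by rewrite divr_gt0 ?subr_gt0 //; nra.
have eD : 4 * D ^+ 2 * e <= x - lam.
  have : e * (4 * D ^+ 2 + 1) = x - lam by rewrite divfK //; apply: lt0r_neq0; nra.
  by nra.
have [k k0 hk] := unitary_recurrent (qa_U_unitary A a) norm2_s0 (exprn_gt0 2 e0).
exists k => //; apply: (@lt_le_trans _ _ ((x + lam) / 2)); first by lra.
set w' := oconcat _ _.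
apply: (@le_trans _ _ (inf (fun y : R => exists i, y =
    sqmod (dotc psi (qa_run A w' (k + n i)%N))))); last first.
  rewrite f_NDE; apply: ub_le_sup; first exact: ND_values_bounded.
  exists psi; do 2!split=> //; exists (fun i => k + n i)%N; split=> // i.
  by rewrite ltn_add2l.
apply: le_inf_values => i; apply: le_trans (_ : x - 2 * D ^+ 2 * e <= _); first by lra.
have runk : apply_word (nseq k a) (qa_s0 A) = iter k (mulmx (qa_U A a)) (qa_s0 A).
  rewrite /apply_word; elim: (k) (qa_s0 A) => //= m IH v.
  by rewrite IH -iterS iterSr.
have -> : qa_run A w' (k + n i) = qa_run A w (n i) +
    run_mx w (n i) *m (iter k (mulmx (qa_U A a)) (qa_s0 A) - qa_s0 A).
  by rewrite mulmxBr -qa_runE addrC subrK -runk -qa_run_oconcat size_nseq.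
rewrite dotcDr; set p := dotc _ _; set q := dotc _ _.
have hq : normc q <= D * e by apply: normc_dotc; rewrite ?norm2_run_mx // ltW.
have hp : normc p <= D by rewrite -[D]mulr1 normc_dotc // norm2_run expr1n.
have hpq : normc p <= normc (p + q) + normc q.
  by rewrite -{1}(addrK q p) -[X in _ <= _ + X]normcN le_normcD.
have := xE i; rewrite -/p !sqmodE.
move: (normc_ge0 p) (normc_ge0 q) (normc_ge0 (p + q)) hp hq hpq.
move: (normc p) (normc q) (normc (p + q)) => P Q T P0 Q0 T0 hp hq hpq hx.
(* This follows from T >= P - Q and P <= D; when P <= Q the left side is not positive. *)
suff : P ^+ 2 - 2 * D * Q <= T ^+ 2 by nra.
have [le_PQ|lt_QP] := leP P Q; first by nra.
have : (P - Q) ^+ 2 <= T ^+ 2 by rewrite ler_pXn2r ?nnegrE //; lra.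
by nra.
Qed.

End Runs.

(** * The value of u c^omega when c acts as the identity *)

Section ConstantTail.
Variables (S : finType) (A : qa S) (c : S) (psi : 'cV[C]_(qa_dim A)).
Hypotheses (Uc : qa_U A c = 1%:M) (psi1 : norm2 psi = 1).
Hypothesis Fpsi : forall phi, in_subspace (qa_F A) phi <-> exists k, phi = k *: psi.

Lemma run_mx_cst n : run_mx A (ocst c) n = 1%:M.
Proof. by elim: n => //= n ->; rewrite Uc mulmx1. Qed.

(** After [u] the run is constant, and a unit vector of the line F is [psi] up to a phase, so all
    subsequences eventually see the same value. *)
Lemma f_ND_cst u : f_ND A (oconcat u (ocst c)) = sqmod (dotc psi (apply_word u (qa_s0 A))).
Proof.
set s := apply_word _ _; set w := oconcat _ _.
have runE n : qa_run A w (size u + n) = s by rewrite qa_run_oconcat run_mx_cst mul1mx.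
have val : ND_values A w (sqmod (dotc psi s)).
  exists psi; split; first by apply/Fpsi; exists 1; rewrite scale1r.
  split; first exact/dotc_unit.
  exists (fun i => size u + i)%N; split=> [i|]; first by rewrite ltn_add2l.
  apply/eqP; rewrite eq_le; apply/andP; split.
    by apply: le_inf_values => i; rewrite runE.
  by have := inf_values_le w psi (fun i => size u + i)%N 0; rewrite runE.
apply/eqP; rewrite eq_le; apply/andP; split; last first.
  by apply: ub_le_sup val; exact: ND_values_bounded.
apply: ge_sup; first by exists (sqmod (dotc psi s)).
move=> _ [phi [/Fpsi [k ->] [/dotc_unit k1 [n [incn ->]]]]].
have nk : sqmod k = 1.
  move: k1; rewrite /norm2; under eq_bigr do rewrite mxE sqmodM.
  by rewrite -mulr_sumr -/(norm2 psi) psi1 mulr1.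
(* Hence the term of index [size u] already lies in the constant part of the run. *)
have le_n i : (i <= n i)%N by elim: i => // i IH; apply: leq_ltn_trans (incn i).
apply: le_trans (inf_values_le w (k *: psi) n (size u)) _.
rewrite -(subnKC (le_n (size u))) runE.
have -> : dotc (k *: psi) s = conjc k * dotc psi s.
  by rewrite /dotc mulr_sumr; apply: eq_bigr => i _; rewrite mxE rmorphM mulrA.
by rewrite sqmodM sqmod_conjc nk mul1r.
Qed.

End ConstantTail.

(** * Automata with diagonal unitaries and a one-dimensional F *)

Section DiagonalAutomaton.
Variables (S : finType) (d : nat) (D : S -> 'I_d.+1 -> C) (s0 psi : 'cV[C]_d.+1).
Hypothesis D1 : forall a i, sqmod (D a i) = 1.
Hypotheses (s01 : norm2 s0 = 1) (psi1 : norm2 psi = 1).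

Lemma unitary_diag a : unitary (diag_mx (\row_i D a i)).
Proof.
rewrite /unitary /adjmx tr_diag_mx map_diag_mx mulmx_diag -diag_const_mx.
by congr diag_mx; apply/rowP => i; rewrite !mxE conjc_mul D1.
Qed.

(** All rows of the matrix given for F equal psi^T, so its row space is the line of [psi]. *)
Definition diag_qa : qa S :=
  QA ((const_mx 1 : 'cV_d.+1) *m psi^T) ((dotc_unit s0).2 s01) unitary_diag.

Lemma diag_qa_subspace phi : in_subspace (qa_F diag_qa) phi <-> exists k, phi = k *: psi.
Proof.
rewrite /in_subspace /=; split=> [|[k ->]].
  move/submx_trans/(_ (submxMl _ _))/sub_rVP => [k e]; exists k.
  by rewrite -[phi]trmxK e linearZ /= trmxK.
rewrite linearZ /= scalemx_sub //; apply/submxP; exists (delta_mx 0 0 : 'rV_d.+1).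
rewrite mulmxA -rowE (_ : row 0 _ = 1%:M) ?mul1mx //.
by apply/matrixP => i j; rewrite !ord1 !mxE.
Qed.

Lemma apply_word_diag u i :
  (apply_word u (qa_s0 diag_qa)) i 0 = \prod_(x <- u) D x i * s0 i 0.
Proof.
rewrite /apply_word /=.
elim: u s0 => [|x u IH] v /=; first by rewrite big_nil mul1r.
by rewrite IH big_cons mul_diag_mx !mxE; ring.
Qed.

Lemma f_ND_diag c u : (forall i, D c i = 1) ->
  f_ND diag_qa (oconcat u (ocst c)) =
  sqmod (\sum_i conjc (psi i 0) * (\prod_(x <- u) D x i * s0 i 0)).
Proof.
move=> Dc; rewrite (@f_ND_cst _ diag_qa c psi) //; last exact: diag_qa_subspace.
  by congr sqmod; apply: eq_bigr => i _; rewrite apply_word_diag.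
by rewrite /= -diag_const_mx; congr diag_mx; apply/rowP => i; rewrite !mxE.
Qed.

End DiagonalAutomaton.

(** * A rotation of infinite order *)

Section Rotation.

Definition z34 : C := Complex (3 / 5) (4 / 5).

Lemma sqmod_z34 : sqmod z34 = 1.
Proof. by rewrite /sqmod /=; field. Qed.

Lemma sqmod_z34X n : sqmod (z34 ^+ n) = 1.
Proof.
elim: n => [|n IH]; last by rewrite exprS sqmodM IH sqmod_z34 mulr1.
by rewrite /sqmod /=; ring.
Qed.

(* (3 + 4i)^n = 3 + 4i modulo 5 for n > 0, so z34 is not a root of unity. *)
Lemma z34X_mod5 n : exists s t : int,
  z34 ^+ n.+1 * (5 ^+ n.+1)%:C%C = Complex (3 + 5 * s%:~R) (4 + 5 * t%:~R).
Proof.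
elim: n => [|n [s [t IH]]].
  exists 0, 0; apply/eqP; rewrite eq_complex /= !expr1; apply/andP.
  by split; apply/eqP => /=; field.
exists (3 * s - 4 * t - 2), (3 * t + 4 * s + 4).
rewrite exprS [5 ^+ _]exprS rmorphM /= mulrACA IH; apply/eqP; rewrite eq_complex /=.
by rewrite !rmorphD !rmorphN !rmorphM /=; apply/andP; split; apply/eqP; field.
Qed.

(** A zero imaginary part would give 4 + 5 t = 0 for an integer t. *)
Lemma Im_z34X n : (0 < n)%N -> complex.Im (z34 ^+ n) != 0.
Proof.
case: n => // n _; apply/eqP => im0; have [s [t]] := z34X_mod5 n.
move: im0; case: (z34 ^+ n.+1) => x y /= -> [_].
rewrite mulr0 mul0r addr0 => /esym/eqP.
have -> : 4 + 5 * t%:~R = (4 + 5 * t)%:~R :> R by rewrite rmorphD rmorphM.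
by rewrite intr_eq0 => /eqP; lia.
Qed.

Lemma z34X_inj : injective (fun n => z34 ^+ n).
Proof.
suff H i j : (i < j)%N -> z34 ^+ i <> z34 ^+ j.
  by move=> i j e; have [/H|/H|] := ltngtP i j => // /(_ _)[].
move=> lt_ij; rewrite -(subnKC (ltnW lt_ij)) exprD => /eqP.
have z0 : z34 ^+ i != 0.
  by apply/eqP => zi; have := sqmod_z34X i; rewrite zi /sqmod /=; lra.
rewrite -{1}[z34 ^+ i]mulr1 (inj_eq (mulfI z0)) => /eqP e.
by have := Im_z34X (n := j - i); rewrite subn_gt0 -e /= eqxx => /(_ lt_ij).
Qed.

End Rotation.

(** * An automaton comparing three letter counts *)

Section CountingAutomaton.

Definition count_phase (x : option 'I_3) (i : 'I_3) : C := if x == Some i then z34 else 1.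

(** Rational amplitudes of norm 1. Used both as initial and as observed state, they yield the
    weights 1/9, 4/9, 4/9. *)
Definition count_state : 'cV[C]_3 := \col_i ((if i == 0 then 1 / 3 else 2 / 3) : R)%:C%C.

Lemma sqmod_count_phase x i : sqmod (count_phase x i) = 1.
Proof. by rewrite /count_phase; case: eqP => _; rewrite ?sqmod_z34 // /sqmod /=; ring. Qed.

Lemma norm2_count_state : norm2 count_state = 1.
Proof. by rewrite /norm2 !big_ord_recl big_ord0 !mxE /sqmod /=; field. Qed.

Definition count_qa : qa (option 'I_3) :=
  diag_qa count_state sqmod_count_phase norm2_count_state.

Let la : option 'I_3 := Some 0.
Let lb : option 'I_3 := Some (lift ord0 0).
Let ld : option 'I_3 := Some (lift ord0 (lift ord0 0)).

(* With weights w_i of sum 1 and unit z_i, 1 - |sum_i w_i z_i|^2 is the sum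
   over i < j of w_i w_j |z_i - z_j|^2. *)
Lemma L_eq1_count u : L_eq1 count_qa (oconcat u (ocst None)) <-> balanced la lb ld u.
Proof.
rewrite /L_eq1 f_ND_diag //; last exact: norm2_count_state.
have prodE i : \prod_(x <- u) count_phase x i = z34 ^+ count_mem (Some i) u.
  rewrite /count_phase -big_mkcond /= big_const_seq.
  by rewrite -Monoid.iteropE.
rewrite !big_ord_recl big_ord0 !mxE !prodE /= -/la -/lb -/ld.
rewrite /balanced.
have inj i j : z34 ^+ i = z34 ^+ j <-> i = j.
  by split=> [/z34X_inj|->].
rewrite -(inj (count_mem la u)) -(inj (count_mem lb u)).
have := sqmod_z34X (count_mem la u); have := sqmod_z34X (count_mem lb u).
have := sqmod_z34X (count_mem ld u).
case: (z34 ^+ count_mem la u) => x0 y0; case: (z34 ^+ count_mem lb u) => x1 y1.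
case: (z34 ^+ count_mem ld u) => x2 y2.
rewrite /sqmod /= => n2 n1 n0.
set lhs := (X in X = 1 <-> _).
have -> : lhs = (9 * (x0 ^+ 2 + y0 ^+ 2) + 36 * (x1 ^+ 2 + y1 ^+ 2) + 36 * (x2 ^+ 2 + y2 ^+ 2)
   - (4 * ((x0 - x1) ^+ 2 + (y0 - y1) ^+ 2) + 4 * ((x0 - x2) ^+ 2 + (y0 - y2) ^+ 2)
   + 16 * ((x1 - x2) ^+ 2 + (y1 - y2) ^+ 2))) / 81 by rewrite /lhs; field.
rewrite n0 n1 n2 {lhs}.
split=> [h|[[-> ->] [-> ->]]]; last by field.
have := sqr_ge0 (x0 - x1); have := sqr_ge0 (y0 - y1).
have := sqr_ge0 (x1 - x2); have := sqr_ge0 (y1 - y2).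
have := sqr_ge0 (x0 - x2); have := sqr_ge0 (y0 - y2).
move=> h1 h2 h3 h4 h5 h6.
have eq0 (x y : R) : (x - y) ^+ 2 = 0 -> x = y.
  by move/eqP; rewrite sqrf_eq0 subr_eq0 => /eqP.
by split; congr Complex; apply: eq0; lra.
Qed.

Lemma count_qa_not_cf : ~ omega_cf (L_eq1 count_qa).
Proof. by apply: not_omega_cf L_eq1_count. Qed.

Lemma count_qa_not_regular : ~ omega_regular (L_eq1 count_qa).
Proof.
apply: (@not_omega_regular _ _ (fun i => nseq i la) (fun j => nseq j lb ++ nseq j ld) None).
move=> i j; rewrite L_eq1_count /balanced !count_cat !count_nseq /=.
by rewrite !mul1n !mul0n !addn0 !add0n; split=> [[]|->].
Qed.

End CountingAutomaton.

(** * An automaton whose diagonal words sit exactly at the threshold *)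

Section ThresholdAutomaton.
Variable lam : R.
Hypothesis lam01 : 0 < lam < 1.

(** [p] and [q] are the cosine and sine of the angle theta with lam = (1 + cos theta) / 2; p + i q
    is the relative phase of the observed state. *)
Let p : R := 2 * lam - 1.
Let q : R := Num.sqrt (1 - p ^+ 2).

Let q2_gt0 : 0 < 1 - p ^+ 2.
Proof.
have -> : 1 - p ^+ 2 = 4 * (lam * (1 - lam)) by rewrite /p; ring.
by do 2?apply: mulr_gt0; have /andP [] := lam01; lra.
Qed.

Let pq1 : p ^+ 2 + q ^+ 2 = 1.
Proof. by rewrite sqr_sqrtr; [ring | exact: ltW]. Qed.

Let q_gt0 : 0 < q.
Proof. by rewrite sqrtr_gt0. Qed.

Definition turn_phase (x : option bool) (i : 'I_2) : C :=
  if i == 0 then (if x is Some s then (if s then z34 else conjc z34) else 1) else 1.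

Definition half_state (k : C) : 'cV[C]_2 :=
  \col_i ((if i == 0 then k else 1) * (Num.sqrt (2^-1) : R)%:C%C).

Lemma sqmod_turn_phase x i : sqmod (turn_phase x i) = 1.
Proof.
have s1 : sqmod 1 = 1 by rewrite /sqmod /=; ring.
rewrite /turn_phase; case: (i == 0) => //; case: x => // -[]; last rewrite sqmod_conjc.
  exact: sqmod_z34.
exact: sqmod_z34.
Qed.

Lemma norm2_half_state k : sqmod k = 1 -> norm2 (half_state k) = 1.
Proof.
move=> k1; have s1 : sqmod 1 = 1 by rewrite /sqmod /=; ring.
rewrite /norm2 !big_ord_recl big_ord0 !mxE /= !sqmodM k1 s1 /sqmod /= sqr_sqrtr; last by lra.
by field.
Qed.

Let n1 : norm2 (half_state 1) = 1.
Proof. by apply: norm2_half_state; rewrite /sqmod /=; ring. Qed.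

Definition turn_qa : qa (option bool) :=
  diag_qa (half_state (Complex p q)) sqmod_turn_phase n1.

Let word i j : oword (option bool) :=
  oconcat (nseq i (Some true) ++ nseq j (Some false)) (ocst None).

(* The observed state is chosen so that the value of a^i b^i c^omega is exactly lam. *)
Lemma f_ND_turn i j : let P := z34 ^+ i * conjc (z34 ^+ j) in
  f_ND turn_qa (word i j) = (1 + (p * complex.Re P + q * complex.Im P)) / 2.
Proof.
move=> P; rewrite /word f_ND_diag; last 2 first.
- exact: norm2_half_state.
- by move=> l; rewrite /turn_phase; case: eqP.
rewrite !big_ord_recl big_ord0 !mxE /= !big_cat !big_nseq /= /turn_phase /=.
have it (x : C) n : iter n ( *%R x) 1 = x ^+ n by rewrite -Monoid.iteropE.
have cX n : conjc z34 ^+ n = conjc (z34 ^+ n) by rewrite rmorphXn.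
rewrite !it !expr1n mul1r cX -/P.
have P1 : sqmod P = 1 by rewrite sqmodM sqmod_conjc !sqmod_z34X mulr1.
move: P1; case: P => x y; rewrite /sqmod /= => P1.
have r2 : (Num.sqrt 2^-1 : R) ^+ 2 = 2^-1 by rewrite sqr_sqrtr //; lra.
move: r2; set r := Num.sqrt _ => r2.
set lhs := (X in X = _).
have -> : lhs = (r ^+ 2) ^+ 2 * ((p * x + q * y + 1) ^+ 2 + (p * y - q * x) ^+ 2).
  by rewrite /lhs; ring.
rewrite r2; have := pq1 => e.
have -> : (p * x + q * y + 1) ^+ 2 + (p * y - q * x) ^+ 2 =
  (p ^+ 2 + q ^+ 2) * (x ^+ 2 + y ^+ 2) + 2 * (p * x + q * y) + 1 by ring.
by rewrite e P1; field.
Qed.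

Lemma turn_qa_not_regular : ~ omega_regular (L_gt lam turn_qa).
Proof.
move=> /omega_regular_finite_index [Q [h hP]].
pose g n (l : bool) : R := if l then complex.Re (z34 ^+ n) else complex.Im (z34 ^+ n).
have g1 n l : `|g n l| <= 1.
  rewrite -(ler_pXn2r (n := 2)) ?nnegrE ?normr_ge0 //= expr1n real_normK ?num_real //.
  by rewrite -(sqmod_z34X n) /g /sqmod; case: l; rewrite ?lerDl ?lerDr sqr_ge0.
(* Closeness q / 4 in both coordinates yields |Y| < q and X > 0 below. *)
have q4 : 0 < q / 4 by have := q_gt0; lra.
have [i [j [lt_ij hij gij]]] :=
  pigeonhole_close (fun n => h (nseq n (Some true))) q4 g1.
have swap m n k : h (nseq m (Some true)) = h (nseq n (Some true)) ->
    L_gt lam turn_qa (word m k) -> L_gt lam turn_qa (word n k).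
  by move=> e; rewrite /word !oconcat_cat; apply: hP.
have diagN n : ~ L_gt lam turn_qa (word n n).
  rewrite /L_gt f_ND_turn [z34 ^+ n * _]mulrC conjc_mul sqmod_z34X /=.
  by rewrite /p; lra.
have := fun H => diagN j (swap i j j hij H).
have := fun H => diagN i (swap j i i (esym hij) H).
rewrite /L_gt !f_ND_turn.
have ImN0 : complex.Im (z34 ^+ j * conjc (z34 ^+ i)) != 0.
  rewrite -(subnKC (ltnW lt_ij)) exprD mulrAC [_ * conjc _]mulrC conjc_mul sqmod_z34X mul1r.
  by apply: Im_z34X; rewrite subn_gt0.
move: ImN0 (gij true) (gij false) (sqmod_z34X i) (sqmod_z34X j); rewrite /g /sqmod.
case: (z34 ^+ i) => x y; case: (z34 ^+ j) => x' y' /=; rewrite !ltr_norml.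
(* X + i Y is z34^(j-i), close to 1 with Y nonzero. *)
set X := x' * x - y' * - y; set Y := x' * - y + y' * x => Y0 dx dy e e'.
have -> : x * x' - y * - y' = X by rewrite /X; ring.
have -> : x * - y' + y * x' = - Y by rewrite /Y; ring.
have XY1 : X ^+ 2 + Y ^+ 2 = 1.
  have -> : X ^+ 2 + Y ^+ 2 = (x ^+ 2 + y ^+ 2) * (x' ^+ 2 + y' ^+ 2) by rewrite /X /Y; ring.
  by rewrite e e' mulr1.
have q0 := q_gt0; have q1 : q <= 1 by have := pq1; nra.
have XE : 1 - X = ((x - x') ^+ 2 + (y - y') ^+ 2) / 2.
  have -> : (x - x') ^+ 2 + (y - y') ^+ 2 = (x ^+ 2 + y ^+ 2) + (x' ^+ 2 + y' ^+ 2) - 2 * X.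
    by rewrite /X; ring.
  by rewrite e e'; field.
have X0 : 0 < X.
  suff : 1 - X < 1 by lra.
  by rewrite XE; nra.
have X1 : X <= 1 by rewrite -subr_ge0 XE divr_ge0 ?addr_ge0 ?sqr_ge0.
have p1 : p <= 1 by rewrite /p; have /andP [_] := lam01; lra.
have YE : Y = x * (y' - y) - y * (x' - x) by rewrite /Y; ring.
have x1 : -1 <= x <= 1 by nra.
have y1 : -1 <= y <= 1 by nra.
have Yq : - q < Y < q by rewrite YE; nra.
have lamE : lam = (1 + p) / 2 by rewrite /p; field.
rewrite lamE => h1 h2.
have {}h1 : p * X + q * Y <= p by rewrite leNgt; apply/negP => ?; apply: h1; lra.
have {}h2 : p * X + q * - Y <= p by rewrite leNgt; apply/negP => ?; apply: h2; lra.
(* Indeed 1 - X <= (1 - X)(1 + X) = Y^2. With [h1] and [h2] this gives q |Y| <= Y^2, impossible for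
   0 < |Y| < q. *)
have pX : p * (1 - X) <= Y ^+ 2.
  by apply: (@le_trans _ _ (1 - X)); nra.
have [Ypos|Yneg|Y00] := ltgtP Y 0.
- by nra.
- by nra.
- by rewrite Y00 eqxx in Y0.
Qed.

End ThresholdAutomaton.

(** * The languages {c^omega} and {a^n b^n c^omega} and the threshold classes *)

Section NotQBA.
Variables (S : finType) (a b c : S).
Hypotheses (ab : a != b) (ac : a != c) (bc : b != c).

Lemma not_in_QBA_gt lam (L : olang S) : 0 <= lam -> L (ocst c) ->
  (forall k, L (oconcat (nseq k a) (ocst c)) -> k = 0%N) -> ~ in_QBA_gt lam L.
Proof.
move=> lam0 Lc La [A LA].
have [k k0 /LA/La k00] := L_gt_prepend a lam0 ((LA _).1 Lc).
by rewrite k00 in k0.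
Qed.

Definition cst_lang : olang S :=
  lconcat (fun u => u = [::]) (omega_pow (fun u => u = [:: c])).

Lemma cst_lang_regular : omega_regular cst_lang.
Proof.
exists 1%N, (fun _ u => u = [::]), (fun _ u => u = [:: c]); split.
  by move=> _ _; split; [exact: regular_nil | exact: regular_letter].
by move=> w; split=> [Lw|[]]; first by exists 0%N.
Qed.

Lemma cst_lang_not_QBA lam : 0 <= lam -> ~ in_QBA_gt lam cst_lang.
Proof.
move=> lam0; apply: not_in_QBA_gt => // [|k].
  by apply/lconcat_letter; exists [::]; rewrite ?oconcat0.
move=> /lconcat_letter [u -> /(count_oconcat_cst ac)] /=.
by rewrite count_nseq /= eqxx mul1n.
Qed.

Definition anbn_lang : olang S :=
  lconcat (fun u => exists n, u = nseq n a ++ nseq n b) (omega_pow (fun u => u = [:: c])).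

Lemma anbn_langE i j : anbn_lang (oconcat (nseq i a ++ nseq j b) (ocst c)) <-> i = j.
Proof.
split=> [/lconcat_letter [_ [n ->] e]|->]; last first.
  by apply/lconcat_letter; exists (nseq j a ++ nseq j b) => //; exists j.
move: (count_oconcat_cst ac e) (count_oconcat_cst bc e).
rewrite !count_cat !count_nseq /= !eqxx (eq_sym b) (negPf ab).
by rewrite !mul1n !mul0n !addn0 !add0n => -> ->.
Qed.

Lemma anbn_lang_cf : omega_cf anbn_lang.
Proof.
exists 1%N, (fun _ u => exists n, u = nseq n a ++ nseq n b), (fun _ u => u = [:: c]); split.
  by move=> _ _; split; [exact: context_free_anbn | exact: context_free_letter].
by move=> w; split=> [Lw|[]]; first by exists 0%N.
Qed.

Lemma anbn_lang_not_regular : ~ omega_regular anbn_lang.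
Proof. exact: not_omega_regular anbn_langE. Qed.

Lemma anbn_lang_not_QBA lam : 0 <= lam -> ~ in_QBA_gt lam anbn_lang.
Proof.
move=> lam0; apply: not_in_QBA_gt => // [|k].
  by have /anbn_langE := erefl 0%N; rewrite /= oconcat0.
by have := anbn_langE k 0; rewrite /= cats0 => -[].
Qed.

End NotQBA.

Theorem theorem8 :
  (* (1) *)
  (forall lam : Rdefinitions.R, 0 <= lam < 1 ->
     exists (S : finType) (L : olang S), omega_regular L /\ ~ in_QBA_gt lam L) /\
  (* (2) *)
  (forall lam : Rdefinitions.R, 0 <= lam < 1 ->
     exists (S : finType) (L : olang S),
       omega_cf L /\ ~ omega_regular L /\ ~ in_QBA_gt lam L) /\
  (* (3) *)
  (forall lam : Rdefinitions.R, 0 < lam < 1 ->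
     exists (S : finType) (A : qa S), ~ omega_regular (L_gt lam A)) /\
  (* (4) *)
  (exists (S : finType) (A : qa S), ~ omega_regular (L_eq1 A)) /\
  (* (5) *)
  (exists (S : finType) (A : qa S), ~ omega_cf (L_eq1 A)).
Proof.
split=> [lam /andP [lam0 _]|].
  exists bool, (cst_lang false); split; first exact: cst_lang_regular.
  exact: (@cst_lang_not_QBA _ true).
split=> [lam /andP [lam0 _]|].
  exists (option bool), (anbn_lang (Some true) (Some false) None).
  split; first exact: anbn_lang_cf.
  by split; [exact: anbn_lang_not_regular | exact: anbn_lang_not_QBA].
split=> [lam lam01|].
  by exists (option bool), (turn_qa lam); exact: turn_qa_not_regular.
split; first by exists (option 'I_3), count_qa; exact: count_qa_not_regular.
by exists (option 'I_3), count_qa; exact: count_qa_not_cf.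
Qed.
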